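(* Let $k\in\{3,4,5\}$ and $d\in\{1,2,\ldots,20\}$. The pairs of integers $(n,m)$ with $n\ge k$ and $m\ge k$ satisfying $$\binom{n}{k}=\binom{m}{k}+d$$ are exactly the following (listed as $(k,d)$: solutions $(n,m)$): $(3,3)$: $(4,3)$; $(3,6)$: $(5,4)$; $(3,9)$: $(5,3)$; $(3,10)$: $(6,5)$; $(3,15)$: $(7,6)$; $(3,16)$: $(6,4)$; $(3,19)$: $(6,3)$; $(4,4)$: $(5,4)$; $(4,10)$: $(6,5)$; $(4,14)$: $(6,4)$; $(4,20)$: $(7,6)$; $(5,5)$: $(6,5)$; $(5,15)$: $(7,6)$; $(5,20)$: $(7,5)$. For every other pair $(k,d)$ with $k\in\{3,4,5\}$, $d\in\{1,\ldots,20\}$, there is no such solution.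
   Context: For an integer $x$ and a positive integer $k$, $\binom{x}{k}=\frac{x(x-1)\cdots(x-k+1)}{k!}$. *)

(* Defs.v *)
From mathcomp Require Import all_boot all_order all_algebra.

Set Implicit Arguments.
Unset Strict Implicit.
Unset Printing Implicit Defensive.

Import Order.TTheory GRing.Theory Num.Theory.
Local Open Scope ring_scope.

(* Valued in rat so that the division by k! is exact. *)
Definition binz (x : int) (k : nat) : rat :=
  (\prod_(i < k) (x - i%:Z)%:~R) / k`!%:R.

(* Each entry is ((k, d), (n, m)). *)
Definition binz_solutions : seq ((nat * nat) * (int * int)) :=
  [:: ((3%N, 3%N), (4%Z, 3%Z));
      ((3%N, 6%N), (5%Z, 4%Z));
      ((3%N, 9%N), (5%Z, 3%Z));
      ((3%N, 10%N), (6%Z, 5%Z));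
      ((3%N, 15%N), (7%Z, 6%Z));
      ((3%N, 16%N), (6%Z, 4%Z));
      ((3%N, 19%N), (6%Z, 3%Z));
      ((4%N, 4%N), (5%Z, 4%Z));
      ((4%N, 10%N), (6%Z, 5%Z));
      ((4%N, 14%N), (6%Z, 4%Z));
      ((4%N, 20%N), (7%Z, 6%Z));
      ((5%N, 5%N), (6%Z, 5%Z));
      ((5%N, 15%N), (7%Z, 6%Z));
      ((5%N, 20%N), (7%Z, 5%Z))].

(* Main.v *)
(* Pascal's rule and monotonicity give C(n,k) - C(m,k) >= C(n-1,k-1) whenever
   C(m,k) < C(n,k).  For k = 3, 4, 5 the right-hand side exceeds 20 as soon as
   n >= 8, so only the finitely many pairs k <= m < n <= 7 remain. *)
Require Import Defs.
From mathcomp Require Import all_boot all_order all_algebra.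

Import Order.TTheory GRing.Theory Num.Theory.
Local Open Scope ring_scope.

(** For [k <= n] every factor [n - i] is a natural number, so the product is the falling factorial
    [n ^_ k], which equals ['C(n, k) * k!]. *)
Lemma binz_nat (n k : nat) : (k <= n)%N -> binz n%:Z k = 'C(n, k)%:R.
Proof.
move=> le_kn; rewrite /binz.
have -> : \prod_(i < k) ((n%:Z - i%:Z)%:~R : rat) = (n ^_ k)%:R.
  rewrite ffact_prod natr_prod; apply: eq_bigr => i _.
  by rewrite subzn // ltnW // (leq_trans (ltn_ord i)).
by rewrite -bin_ffact natrM mulfK // pnatr_eq0 -lt0n fact_gt0.
Qed.

Lemma ltn_bin2l_inv (m n k : nat) : ('C(m, k) < 'C(n, k))%N -> (m < n)%N.
Proof. by apply: contraTT; rewrite -!leqNgt; apply: leq_bin2l. Qed.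

Lemma leq_bin_gap (n m k d : nat) :
  (0 < d)%N -> 'C(n, k.+1) = ('C(m, k.+1) + d)%N -> ('C(n.-1, k) <= d)%N.
Proof.
move=> d_gt0 eq_nm.
have lt_mn : (m < n)%N.
  by apply: (@ltn_bin2l_inv _ _ k.+1); rewrite eq_nm -[ltnLHS]addn0 ltn_add2l.
case: n lt_mn eq_nm => // n; rewrite ltnS binS => le_mn eq_nm.
(* Here [n] is the predecessor of the original one. Adding ['C(m, k.+1)] to both sides and
   cancelling ['C(n, k)] leaves ['C(m, k.+1) <= 'C(n, k.+1)], true since [m <= n]. *)
by rewrite -(leq_add2l 'C(m, k.+1)) -eq_nm leq_add2r leq_bin2l.
Qed.

Lemma bin_gap_le20_bound (n m k d : nat) : k \in [:: 3; 4; 5]%N ->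
  (1 <= d <= 20)%N -> 'C(n, k) = ('C(m, k) + d)%N -> (n < 8)%N.
Proof.
case: k => // k k_in /andP[d_gt0 d_le20] /(leq_bin_gap _ _ _ _ d_gt0) le_d.
rewrite ltnNge; apply/negP => n_ge8.
(* Now [k] is 2, 3 or 4, shifted down by one, and ['C(7, k)] is 21, 35 or 35: a contradiction in
   each case. *)
have: ('C(7, k) <= 20)%N.
  apply: leq_trans d_le20; apply: leq_trans le_d; apply: leq_bin2l.
  by case: n n_ge8.
by move: k_in; rewrite !inE !eqSS => /or3P[] /eqP->.
Qed.

(** Comparing the two booleans for equality makes one computation serve both directions:
    completeness of the list and validity of its entries. *)
Lemma binz_solutions_small : all (fun k : nat => all (fun n : nat =>
  all (fun m : nat => all (fun d : nat =>
    [&& (k <= n)%N, (k <= m)%N & 'C(n, k) == ('C(m, k) + d)%N]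
    == (((k, d), (n%:Z, m%:Z)) \in binz_solutions)) (iota 1 20))
  (iota 0 8)) (iota 0 8)) [:: 3; 4; 5]%N.
Proof. by vm_compute. Qed.

(** Places every listed pair inside the box covered by the finite check, as the converse direction
    requires. *)
Lemma binz_solutions_bound : all (fun s : (nat * nat) * (int * int) =>
  [&& 0 <= s.2.1, s.2.1 < 8, 0 <= s.2.2 & s.2.2 < 8]) binz_solutions.
Proof. by vm_compute. Qed.

Theorem theorem2 (k d : nat) (hk : k \in [:: 3%N; 4%N; 5%N])
    (hd : (1 <= d <= 20)%N) (n m : int) :
  [/\ k%:Z <= n, k%:Z <= m & binz n k = binz m k + d%:R] <->
  ((k, d), (n, m)) \in binz_solutions.
Proof.
have small (n' m' : nat) : (n' < 8)%N -> (m' < 8)%N ->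
    [&& (k <= n')%N, (k <= m')%N & 'C(n', k) == ('C(m', k) + d)%N]
    = (((k, d), (n'%:Z, m'%:Z)) \in binz_solutions).
  move=> n'_lt8 m'_lt8.
  move/allP: binz_solutions_small => /(_ k hk)/allP/(_ n').
  rewrite mem_iota => /(_ n'_lt8)/allP/(_ m'); rewrite mem_iota => /(_ m'_lt8).
  by move=> /allP/(_ d); rewrite mem_iota => /(_ hd)/eqP.
split=> [[]|sol].
  (* Negative [n] or [m] contradicts the lower bound [k]. *)
  case: n m => [n|n] [m|m] // le_kn le_km.
  rewrite !binz_nat // -natrD => /eqP; rewrite eqr_nat => /eqP eq_nm.
  have n_lt8 := bin_gap_le20_bound _ _ _ _ hk hd eq_nm.
  have lt_mn : (m < n)%N.
    apply: (@ltn_bin2l_inv _ _ k).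
    by rewrite eq_nm -[ltnLHS]addn0 ltn_add2l; case/andP: hd.
  rewrite -small //; last exact: ltn_trans n_lt8.
  by apply/and3P; split=> //; apply/eqP.
move/allP: binz_solutions_bound => /(_ _ sol) /=.
case: n m sol => [n|n] [m|m] sol /and4P[] // _ n_lt8 _ m_lt8.
move: sol; rewrite -small // => /and3P[le_kn le_km /eqP eq_nm].
by split; rewrite ?lez_nat // !binz_nat // eq_nm natrD.
Qed.
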